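(* Let $c,\tilde c\in\mathbb{R}^{S\times A}$ be the true and the falsified cost matrices, let $Q^*\in\mathbb{R}^{S\times A}$ be the $Q$-factor learned by $Q$-learning with the true cost $c$, and let $\tilde Q^*\in\mathbb{R}^{S\times A}$ be the $Q$-factor learned by $Q$-learning with the falsified cost $\tilde c$. Then there exists a constant $L<1$ such that $$\Vert\tilde Q^*-Q^*\Vert\le\frac{1}{1-L}\Vert\tilde c-c\Vert,$$ and one can take $L=\beta$, where $\beta$ is the discount factor.
   Context: Finite Markov decision process: $\mathcal S=\{1,\dots,S\}$ is a finite state space, $\mathcal A=\{a_1,\dots,a_A\}$ a finite action space, $p(i,j,a)$ is the probability of moving from state $i$ to state $j$ under action $a$ (so $p(i,j,a)\ge 0$, $\sum_j p(i,j,a)=1$), and $\beta\in(0,1)$ is the discount factor. $\Vert\cdot\Vert$ is the maximum norm on $\mathbb{R}^{S\times A}$, $\Vert Q\Vert=\max_{i,a}|Q(i,a)|$. For a cost matrix $d\in\mathbb{R}^{S\times A}$, the $Q$-factor learned with cost $d$ is the (almost sure) limit of the $Q$-learning algorithm run with cost $d$; it is the unique $Q\in\mathbb{R}^{S\times A}$ satisfying $$Q(i,a)=d(i,a)+\beta\sum_{j\in\mathcal S}p(i,j,a)\min_{b\in\mathcal A}Q(j,b)\quad\text{for all } i\in\mathcal S,\ a\in\mathcal A.$$ *)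

(* Defs.v *)
From HB Require Import structures.
From mathcomp Require Export all_boot all_order all_algebra.
From mathcomp Require Export reals matrix_normedtype.
#[export] Set Implicit Arguments.
#[export] Unset Strict Implicit.
#[export] Unset Printing Implicit Defensive.

Export Order.TTheory GRing.Theory Num.Theory.
Local Open Scope ring_scope.

(* There are S.+1 states and A.+1 actions, so both index types are nonempty.
   A cost or a Q-factor is a matrix with rows indexed by states and columns
   by actions; its norm `|Q| is the library's norm mx_norm on matrices, which
   is the entrywise maximum norm (see mx_normrE). *)

Definition is_transition (R : realType) (S A : nat)
    (p : 'I_S.+1 -> 'I_S.+1 -> 'I_A.+1 -> R) : Prop :=
  (forall i j a, 0 <= p i j a) /\ (forall i a, \sum_j p i j a = 1).

(* The default value Q j ord0 is itself one of the entries, so this is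
   exactly the minimum of row j. *)
Definition min_action (R : realType) (S A : nat)
    (Q : 'M[R]_(S.+1, A.+1)) (j : 'I_S.+1) : R :=
  \big[Num.min/Q j ord0]_(b < A.+1) Q j b.

(* Q-learning with cost d converges almost surely to the solution Q of this
   fixed-point equation. When p is a transition kernel and 0 < beta < 1, the
   right-hand side is a contraction in Q, so the solution exists and is unique;
   the predicate then determines Q from d. *)
Definition is_Qfactor (R : realType) (S A : nat)
    (p : 'I_S.+1 -> 'I_S.+1 -> 'I_A.+1 -> R) (beta : R)
    (d Q : 'M[R]_(S.+1, A.+1)) : Prop :=
  forall i a, Q i a = d i a + beta * \sum_j p i j a * min_action Q j.

(* Main.v *)
Require Import Defs.
Local Open Scope ring_scope.

(** The Bellman operator is a [beta]-contraction for the maximum norm, because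
    taking a minimum over actions is 1-Lipschitz and averaging over the next
    state does not increase the norm. Subtracting the two fixed-point equations
    gives [`|Qt - Q| <= `|ct - c| + beta * `|Qt - Q|]. *)

Lemma mx_entry_le_norm (R : realType) (m n : nat) (M : 'M[R]_(m.+1, n.+1)) i j :
  `|M i j| <= `|M|.
Proof.
rewrite [leRHS]mx_normrE.
exact: (le_bigmax _ (fun ij : 'I_m.+1 * 'I_n.+1 => `|M ij.1 ij.2|) (i, j)).
Qed.

Lemma mx_norm_le (R : realType) (m n : nat) (M : 'M[R]_(m.+1, n.+1)) (x : R) :
  (forall i j, `|M i j| <= x) -> `|M| <= x.
Proof.
move=> Mx; rewrite [leLHS]mx_normrE; apply: bigmax_le => [|ij _]; last exact: Mx.
(* The maximum starts from the default [0], so [0 <= x] is needed; it follows from the entry at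
   [ord0], [ord0]. *)
exact: le_trans (normr_ge0 _) (Mx ord0 ord0).
Qed.

Lemma min_action_leD (R : realType) (S A : nat) (Q Q' : 'M[R]_(S.+1, A.+1)) j :
  min_action Q j <= min_action Q' j + `|Q - Q'|.
Proof.
rewrite -lerBlDr.
have le_min b : min_action Q j - `|Q - Q'| <= Q' j b.
  rewrite lerBlDr; apply: (le_trans (bigmin_le _ b _)).
  rewrite -lerBlDl; apply: le_trans (mx_entry_le_norm (Q - Q') j b).
  by rewrite !mxE ler_norm.
(* The default [Q' j ord0] is an entry of the row, so [le_min] bounds it too. *)
by apply: le_bigmin => [|b _]; exact: le_min.
Qed.

Lemma min_action_lipschitz (R : realType) (S A : nat)
    (Q Q' : 'M[R]_(S.+1, A.+1)) j :
  `|min_action Q j - min_action Q' j| <= `|Q - Q'|.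
Proof.
by rewrite ler_distlC lerBlDr min_action_leD [`|Q - Q'|]distrC min_action_leD.
Qed.

Lemma transition_average_le (R : realType) (S A : nat)
    (p : 'I_S.+1 -> 'I_S.+1 -> 'I_A.+1 -> R) (hp : is_transition p)
    (f : 'I_S.+1 -> R) (x : R) (fx : forall j, `|f j| <= x) i a :
  `|\sum_j p i j a * f j| <= x.
Proof.
have [p_ge0 p_sum1] := hp.
(* Writing [x] as the average of the constant [x] allows a termwise comparison. *)
rewrite -[leRHS]mul1r -(p_sum1 i a) mulr_suml.
apply: (le_trans (ler_norm_sum _ _ _)); apply: ler_sum => j _.
by rewrite normrM ger0_norm // ler_wpM2l.
Qed.

Lemma Qfactor_dist_le (R : realType) (S A : nat)
    (p : 'I_S.+1 -> 'I_S.+1 -> 'I_A.+1 -> R) (hp : is_transition p)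
    (beta : R) (beta_ge0 : 0 <= beta) (c c' Q Q' : 'M[R]_(S.+1, A.+1))
    (hQ : is_Qfactor p beta c Q) (hQ' : is_Qfactor p beta c' Q') :
  `|Q - Q'| <= `|c - c'| + beta * `|Q - Q'|.
Proof.
apply: mx_norm_le => i a.
(* Both equations average with the same kernel [p], so the minima subtract state by state. *)
have -> : (Q - Q') i a = (c - c') i a +
    beta * \sum_j p i j a * (min_action Q j - min_action Q' j).
  rewrite !mxE hQ hQ' opprD addrACA -mulrBr -sumrB.
  by congr (_ + _ * _); apply: eq_bigr => j _; rewrite mulrBr.
apply: (le_trans (ler_normD _ _)); apply: lerD; first exact: mx_entry_le_norm.
rewrite normrM (ger0_norm beta_ge0) ler_wpM2l //.
by apply: transition_average_le => // j; exact: min_action_lipschitz.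
Qed.

Theorem theorem1 (R : realType) (S A : nat)
    (p : 'I_S.+1 -> 'I_S.+1 -> 'I_A.+1 -> R) (hp : is_transition p)
    (beta : R) (hbeta0 : 0 < beta) (hbeta1 : beta < 1)
    (c ct Q Qt : 'M[R]_(S.+1, A.+1))
    (hQ : is_Qfactor p beta c Q) (hQt : is_Qfactor p beta ct Qt) :
  (exists L : R, L < 1 /\ `|Qt - Q| <= 1 / (1 - L) * `|ct - c|) /\
  (beta < 1 /\ `|Qt - Q| <= 1 / (1 - beta) * `|ct - c|).
Proof.
have le_beta : `|Qt - Q| <= 1 / (1 - beta) * `|ct - c|.
  (* Since [1 - beta > 0], the bound can be cleared of its denominator. *)
  rewrite mul1r ler_pdivlMl ?subr_gt0 // mulrBl mul1r lerBlDr.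
  exact: (Qfactor_dist_le hp (ltW hbeta0) hQt hQ).
by split; first exists beta.
Qed.
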